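(* The principle $(\star_s)$ implies that every Aronszajn tree is $(\mathcal{NS}^+,\mathcal{NS}^* )$-special.
   Context: $[\theta]^{\le\aleph_0}$: countable subsets of $\theta$; $x\subseteq^*y$ iff $x\setminus y$ finite; $\downarrow\mathcal H=\bigcup_{x\in\mathcal H}\mathcal P(x)$; a set is locally in $\mathcal K$ if all its countable subsets are in $\mathcal K$; $B$ is orthogonal to $\mathcal H$ if $B\cap x$ is finite for all $x\in\mathcal H$; $\sigma$-directed means every countable subset has an upper bound in the family. $(\star_s)$: for every ordinal $\theta$ of uncountable cofinality there is a maximal antichain $\mathcal A$ of the partial order (stationary subsets of $\theta$, $\subseteq$) such that for every $\sigma$-directed subfamily $\mathcal H$ of $([\theta]^{\le\aleph_0},\subseteq^* )$, either (1) every $S\in\mathcal A$ has an uncountable $C\subseteq S$, relatively closed in $S$, locally in $\downarrow\mathcal H$, or (2) there is a stationary subset of $\theta$ orthogonal to $\mathcal H$. For a tree $T$ of height $\omega_1$ with $\alpha$-th level $T_\alpha$ and $C\subseteq\omega_1$, $T\restriction C=\bigcup_{\alpha\in C}T_\alpha$. A tree is special if it is a countable union of antichains. An $\omega_1$-tree $T$ is $(\mathcal{NS}^+,\mathcal{NS}^* )$-special if there is a maximal antichain $\mathcal A$ of (stationary subsets of $\omega_1$, $\subseteq$) such that every $S\in\mathcal A$ has a relatively closed $C\subseteq S$ for which $T\restriction C$ is special. An Aronszajn tree is an $\omega_1$-tree (height $\omega_1$, countable levels) with no uncountable branch. *)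

(* Defs.v *)
From Stdlib Require Import List.

Set Implicit Arguments.

Definition countable {X : Type} (A : X -> Prop) : Prop :=
  exists f : X -> nat, forall a b, A a -> A b -> f a = f b -> a = b.

Definition finite {X : Type} (A : X -> Prop) : Prop :=
  exists l : list X, forall a, A a -> In a l.

Definition subset {X : Type} (A B : X -> Prop) : Prop := forall a, A a -> B a.

Definition almost_subset {X : Type} (x y : X -> Prop) : Prop :=
  finite (fun a => x a /\ ~ y a).

Record Ord : Type := {
  ocar :> Type;
  olt : ocar -> ocar -> Prop;
  olt_wf : well_founded olt;
  olt_trans : forall a b c, olt a b -> olt b c -> olt a c;
  olt_total : forall a b, olt a b \/ a = b \/ olt b a
}.

Arguments olt {o} _ _.

Section OrdNotions.
Variable th : Ord.

Definition uncountable_cof : Prop :=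
  forall X : th -> Prop, countable X -> exists b : th, forall a, X a -> olt a b.

Definition limit_point (C : th -> Prop) (g : th) : Prop :=
  (exists c, C c /\ olt c g) /\
  (forall b, olt b g -> exists c, C c /\ olt b c /\ olt c g).

Definition closed (C : th -> Prop) : Prop :=
  forall g, limit_point C g -> C g.

Definition unbounded (C : th -> Prop) : Prop :=
  forall a, exists c, C c /\ olt a c.

Definition club (C : th -> Prop) : Prop := closed C /\ unbounded C.

Definition stationary (S : th -> Prop) : Prop :=
  forall C, club C -> exists g, S g /\ C g.

Definition rel_closed_in (S C : th -> Prop) : Prop :=
  subset C S /\ forall g, S g -> limit_point C g -> C g.

(** maximal antichain of the partial order (stationary subsets of theta, ⊆):
    members are stationary, distinct members have no common stationary subset
    (i.e. their intersection is nonstationary), and every stationary set is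
    compatible with some member. *)
Definition max_antichain_stat (A : (th -> Prop) -> Prop) : Prop :=
  (forall S, A S -> stationary S) /\
  (forall S T, A S -> A T -> S <> T ->
     ~ stationary (fun a => S a /\ T a)) /\
  (forall S, stationary S -> exists T, A T /\ stationary (fun a => S a /\ T a)).

Definition sigma_directed (H : (th -> Prop) -> Prop) : Prop :=
  (forall x, H x -> countable x) /\
  (forall G : (th -> Prop) -> Prop, subset G H -> countable G ->
     exists y, H y /\ forall x, G x -> almost_subset x y).

Definition in_down (H : (th -> Prop) -> Prop) (z : th -> Prop) : Prop :=
  exists x, H x /\ subset z x.

Definition locally_in_down (H : (th -> Prop) -> Prop) (C : th -> Prop) : Prop :=
  forall z, subset z C -> countable z -> in_down H z.

Definition orthogonal (H : (th -> Prop) -> Prop) (B : th -> Prop) : Prop :=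
  forall x, H x -> finite (fun a => B a /\ x a).

End OrdNotions.

Arguments uncountable_cof : clear implicits.
Arguments limit_point {th} C g.
Arguments closed {th} C.
Arguments unbounded {th} C.
Arguments club {th} C.
Arguments stationary {th} S.
Arguments rel_closed_in {th} S C.
Arguments max_antichain_stat {th} A.
Arguments sigma_directed {th} H.
Arguments in_down {th} H z.
Arguments locally_in_down {th} H C.
Arguments orthogonal {th} H B.

Definition star_s : Prop :=
  forall th : Ord, uncountable_cof th ->
  exists A : (th -> Prop) -> Prop,
    max_antichain_stat A /\
    forall H : (th -> Prop) -> Prop, sigma_directed H ->
      (forall S, A S -> exists C : th -> Prop,
          rel_closed_in S C /\ ~ countable C /\ locally_in_down H C)
      \/
      (exists B : th -> Prop, stationary B /\ orthogonal H B).

Definition is_omega1 (w : Ord) : Prop :=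
  ~ countable (fun _ : w => True) /\
  forall a : w, countable (fun b => olt b a).

Section Trees.
Variables (w : Ord) (T : Type) (tlt : T -> T -> Prop) (ht : T -> w).

Definition is_tree : Prop :=
  (forall s, ~ tlt s s) /\
  (forall r s t, tlt r s -> tlt s t -> tlt r t) /\
  (forall t r s, tlt r t -> tlt s t -> tlt r s \/ r = s \/ tlt s r) /\
  well_founded tlt.

(** ht is the height function of the tree, with values in w:
    ht t is the order type of the predecessors of t. *)
Definition is_height : Prop :=
  (forall s t, tlt s t -> olt (ht s) (ht t)) /\
  (forall t a, olt a (ht t) -> exists s, tlt s t /\ ht s = a).

Definition omega1_tree : Prop :=
  is_tree /\ is_height /\
  (forall a : w, exists t, ht t = a) /\
  (forall a : w, countable (fun t => ht t = a)).

Definition chain (b : T -> Prop) : Prop :=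
  forall s t, b s -> b t -> tlt s t \/ s = t \/ tlt t s.

Definition branch (b : T -> Prop) : Prop :=
  chain b /\ forall c, chain c -> subset b c -> subset c b.

Definition aronszajn : Prop :=
  omega1_tree /\ ~ exists b, branch b /\ ~ countable b.

Definition restr (C : w -> Prop) (t : T) : Prop := C (ht t).

Definition antichain (X : T -> Prop) : Prop :=
  forall s t, X s -> X t -> ~ tlt s t.

Definition special (X : T -> Prop) : Prop :=
  exists An : nat -> T -> Prop,
    (forall n, antichain (An n)) /\
    (forall n, subset (An n) X) /\
    (forall t, X t -> exists n, An n t).

Definition NS_special : Prop :=
  exists A : (w -> Prop) -> Prop,
    max_antichain_stat A /\
    forall S, A S -> exists C : w -> Prop,
      rel_closed_in S C /\ ~ countable C /\ special (restr C).

End Trees.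

Arguments is_tree {T} tlt.
Arguments is_height {w T} tlt ht.
Arguments omega1_tree {w T} tlt ht.
Arguments chain {T} tlt b.
Arguments branch {T} tlt b.
Arguments aronszajn {w T} tlt ht.
Arguments restr {w T} ht C t.
Arguments antichain {T} tlt X.
Arguments special {T} tlt X.
Arguments NS_special {w T} tlt ht.

(* Main.v *)
(** Fix on every level [T_a] an injective coding of its nodes by natural
    numbers.  Let [H] consist of the countable [x] such that, for all [n] and
    all [t], only finitely many [a] in [x] have their node with code [n] below
    [t].  Diagonalizing over the countably many [t] of bounded height, [H] is
    sigma-directed.  If [C] is locally in the downward closure of [H], then the
    nodes with code [n] on the levels in [C] have finitely many predecessors of
    the same kind, so [T] restricted to [C] is special.  On the other hand no
    uncountable [B] is orthogonal to [H]: otherwise there are a fixed finite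
    number [N] and, for each [d], nodes [s_0, ..., s_(N-1)] such that every
    level [a] in [B] between a fixed bound and [d] has a node with code [< N]
    below some [s_k]; as finitely many pairs (code, k) are involved, this yields
    an uncountable branch. *)

From Stdlib Require Import List Arith Lia Cantor Classical.
From Stdlib Require Import IndefiniteDescription FinFun.
Require Import Defs.

(** * Countable and finite sets *)

Section Countability.
Context {X : Type}.
Implicit Types A B : X -> Prop.

Lemma countable_subset A B : subset A B -> countable B -> countable A.
Proof. intros hs [f hf]; exists f; intros a b ha hb; apply hf; auto. Qed.

Lemma countable_Union {I : Type} (J : I -> Prop) (F : I -> X -> Prop) :
  countable J -> (forall i, J i -> countable (F i)) ->
  countable (fun a => exists i, J i /\ F i a).
Proof.
  intros [g hg] hF.
  assert (hF' : forall i, exists f : X -> nat,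
    J i -> forall a b, F i a -> F i b -> f a = f b -> a = b).
  { intros i; destruct (classic (J i)) as [hi|hi].
    - destruct (hF i hi) as [f hf]; exists f; auto.
    - exists (fun _ => 0); tauto. }
  apply functional_choice in hF'; destruct hF' as [f hf].
  assert (hp : forall a, exists m, (exists i, J i /\ F i a) ->
    exists i, J i /\ F i a /\ m = to_nat (g i, f i a)).
  { intros a; destruct (classic (exists i, J i /\ F i a)) as [[i hi]|hi].
    - exists (to_nat (g i, f i a)); intros _; exists i; tauto.
    - exists 0; tauto. }
  apply functional_choice in hp; destruct hp as [p hp].
  exists p; intros a b ha hb hab.
  destruct (hp a ha) as [i [hi [hia ea]]]; destruct (hp b hb) as [j [hj [hjb eb]]].
  rewrite ea, eb in hab; apply to_nat_inj in hab; injection hab as e1 e2.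
  assert (i = j) by auto; subst j; eapply hf; eauto.
Qed.

Lemma countable_setU A B :
  countable A -> countable B -> countable (fun a => A a \/ B a).
Proof.
  intros hA hB.
  apply countable_subset with
    (B := fun a => exists i : bool, True /\ (if i then A else B) a).
  - intros a [h|h]; [exists true|exists false]; auto.
  - apply countable_Union.
    + exists (fun i : bool => if i then 0 else 1).
      intros [|] [|]; simpl; congruence.
    + intros [|]; auto.
Qed.

Lemma countable_singleton (x : X) : countable (fun a => a = x).
Proof. exists (fun _ => 0); congruence. Qed.

Lemma countable_range (e : nat -> X) : countable (fun a => exists n, a = e n).
Proof.
  apply countable_subset with (B := fun a => exists n, True /\ a = e n).
  - intros a [n h]; eauto.
  - apply countable_Union.
    + exists (fun n => n); auto.
    + intros n _; apply countable_singleton.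
Qed.

Lemma countable_enum (x0 : X) A :
  countable A -> exists e : nat -> X, forall a, A a -> exists n, e n = a.
Proof.
  intros [f hf].
  assert (h : forall n, exists x, forall a, A a -> f a = n -> x = a).
  { intros n; destruct (classic (exists a, A a /\ f a = n)) as [[a [ha e]]|no].
    - exists a; intros b hb eb; apply hf; auto; congruence.
    - exists x0; intros b hb eb; destruct no; eauto. }
  apply functional_choice in h; destruct h as [e he].
  exists e; intros a ha; exists (f a); apply he; auto.
Qed.

Lemma uncountable_diff A B :
  ~ countable A -> countable B -> exists a, A a /\ ~ B a.
Proof.
  intros hA hB; apply NNPP; intros no; apply hA.
  apply countable_subset with (2 := hB).
  intros a ha; apply NNPP; intros hb; eauto.
Qed.

Lemma finite_subset A B : subset A B -> finite B -> finite A.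
Proof. intros hs [l hl]; exists l; auto. Qed.

Lemma finite_bigU (F : nat -> X -> Prop) (N : nat) :
  (forall n, n < N -> finite (F n)) ->
  finite (fun a => exists n, n < N /\ F n a).
Proof.
  induction N as [|N IH]; intros hF.
  - exists nil; intros a [n [h _]]; lia.
  - destruct IH as [l hl]; [auto|].
    destruct (hF N) as [l' hl']; [auto|].
    exists (l ++ l'); intros a [n [hn ha]]; apply in_or_app.
    destruct (Nat.eq_dec n N) as [->|ne]; [auto|].
    left; apply hl; exists n; split; [lia|auto].
Qed.

Lemma injective_range_infinite (e : nat -> X) :
  Injective e -> ~ finite (fun a => exists n, a = e n).
Proof.
  intros inj [l hl].
  assert (h : length (map e (seq 0 (S (length l)))) <= length l).
  { apply NoDup_incl_length.
    - apply Injective_map_NoDup; [auto|apply seq_NoDup].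
    - intros a ha; apply in_map_iff in ha; destruct ha as [n [<- _]]; eauto. }
  rewrite length_map, length_seq in h; lia.
Qed.

End Countability.

(** * Countable initial segments and stationary subsets of omega_1 *)

Section Omega1.
Context {w : Ord}.

Lemma olt_irrefl (a : w) : ~ olt a a.
Proof.
  induction a as [a IH] using (well_founded_ind (olt_wf w)).
  intros h; exact (IH a h h).
Qed.

Context (hw : is_omega1 w).

Lemma omega1_countable_le (a : w) : countable (fun b => olt b a \/ b = a).
Proof. apply countable_setU; [apply hw|apply countable_singleton]. Qed.

(** Without a strict upper bound for [X], the order [w] would be a countable union of countable
    initial segments. *)
Lemma omega1_uncountable_cof : uncountable_cof w.
Proof.
  intros X hX; apply NNPP; intros no; apply (proj1 hw).
  apply countable_subset with
    (B := fun b => exists a, X a /\ (olt b a \/ b = a)).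
  - intros b _; apply NNPP; intros nb; apply no; exists b; intros a ha.
    destruct (olt_total w a b) as [h|[h|h]]; [auto| |];
      destruct nb; exists a; auto.
  - apply countable_Union; [auto|intros a _; apply omega1_countable_le].
Qed.

Lemma omega1_bound_seq (e : nat -> w) : exists b, forall n, olt (e n) b.
Proof.
  destruct (omega1_uncountable_cof _ (countable_range e)) as [b hb]; eauto.
Qed.

Lemma omega1_bound2 (a b : w) : exists c, olt a c /\ olt b c.
Proof.
  destruct (omega1_bound_seq (fun n => match n with 0 => a | _ => b end))
    as [c hc].
  exists c; split; [apply (hc 0)|apply (hc 1)].
Qed.

(** A countable set has a strict upper bound, and the elements above that bound form a club disjoint
    from the set. *)
Lemma stationary_uncountable (S : w -> Prop) : stationary S -> ~ countable S.
Proof.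
  intros hS hc; destruct (omega1_uncountable_cof _ hc) as [b hb].
  destruct (hS (fun c => olt b c)) as [g [hg hbg]].
  - split.
    + intros g [[c [h1 h2]] _]; eapply olt_trans; eauto.
    + intros a; destruct (omega1_bound2 a b) as [c [h1 h2]]; eauto.
  - apply (olt_irrefl g); eapply olt_trans; eauto.
Qed.

End Omega1.

(** * Thin sets of levels, specialness and uncountable chains *)

Section CodedTree.
Context {w : Ord} (hw : is_omega1 w).
Context {T : Type} (tlt : T -> T -> Prop) (ht : T -> w).
Context (htree : is_tree tlt) (hht : is_height tlt ht).
Context (code : T -> nat).
Context (hcode : forall s t, ht s = ht t -> code s = code t -> s = t).

Let tlt_trans : forall r s t, tlt r s -> tlt s t -> tlt r t.
Proof. apply htree. Qed.

Lemma levels_countable (d : w) : countable (fun t => ht t = d).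
Proof. exists code; intros s t hs ht'; apply hcode; congruence. Qed.

Definition hit (a : w) (n : nat) (t : T) : Prop :=
  exists s, ht s = a /\ code s = n /\ tlt s t.

Definition thin (x : w -> Prop) : Prop :=
  countable x /\ forall n t, finite (fun a => x a /\ hit a n t).

(** The countably many nodes of height at most [d] suffice: a higher node has a predecessor on level
    [d], and below that level both have the same predecessors. *)
Lemma hit_enum (t0 : T) (d : w) :
  exists e : nat -> T, forall t, exists j,
    forall a n, olt a d -> hit a n t -> hit a n (e j).
Proof.
  destruct (countable_enum t0 (fun t => exists a, (olt a d \/ a = d) /\ ht t = a))
    as [e he].
  { apply countable_Union; [apply omega1_countable_le; auto|].
    intros a _; apply levels_countable. }
  exists e; intros t.
  assert (hlow : (olt (ht t) d \/ ht t = d) \/ olt d (ht t))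
    by (destruct (olt_total w (ht t) d) as [h|[h|h]]; auto).
  destruct hlow as [h|h].
  - destruct (he t) as [j hj]; [eauto|].
    exists j; rewrite hj; auto.
  - destruct (proj2 hht t d h) as [r [hrt hr]].
    destruct (he r) as [j hj]; [exists d; auto|].
    exists j; rewrite hj; intros a n ha [s [hs [hn hst]]].
    exists s; repeat split; auto.
    destruct (proj1 (proj2 (proj2 htree)) t s r hst hrt) as [h'|[h'|h']]; auto.
    + exfalso; apply (olt_irrefl a); rewrite <- hs at 2; rewrite h', hr; auto.
    + exfalso; apply (olt_irrefl a); apply olt_trans with d; auto.
      rewrite <- hs, <- hr; apply hht; auto.
Qed.

Lemma thin_sigma_directed (t0 : T) : sigma_directed thin.
Proof.
  split; [intros x hx; apply hx|].
  intros G hG hGc.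
  assert (h0 : thin (fun _ => False)).
  { split; [exists (fun _ => 0); tauto|intros n t; exists nil; tauto]. }
  assert (hx : exists x : nat -> w -> Prop,
    (forall m, thin (x m)) /\ forall y, G y -> exists m, x m = y).
  { destruct (countable_enum (fun _ => False) G hGc) as [e he].
    (* The enumeration may leave [G]; values outside are replaced by a thin set, so that every [x m]
       is thin. *)
    assert (h : forall m, exists y, thin y /\ (G (e m) -> y = e m)).
    { intros m; destruct (classic (G (e m))) as [g|g].
      - exists (e m); auto.
      - exists (fun _ => False); tauto. }
    apply functional_choice in h; destruct h as [x hx].
    exists x; split; [apply hx|].
    intros y hy; destruct (he y hy) as [m hm]; exists m; subst y.
    apply hx; auto. }
  destruct hx as [x [hx hGx]].
  assert (hU : countable (fun a => exists m, True /\ x m a)).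
  { apply countable_Union; [exists (fun n => n); auto|].
    intros m _; apply hx. }
  destruct (omega1_uncountable_cof hw _ hU) as [d hd].
  destruct (hit_enum t0 d) as [e he].
  (* Points of [x m] hit by code n under [e j] with n, j < m are cut out. So such a pair hits only
     points kept from [x m] with m at most n + j, while each [x m] loses finitely many points. *)
  exists (fun a => exists m, x m a /\
    forall n j, n < m -> j < m -> ~ hit a n (e j)).
  split; [split|].
  - apply countable_subset with (2 := hU); intros a [m [ha _]]; eauto.
  - intros n t; destruct (he t) as [j hj].
    apply finite_subset with
      (B := fun a => exists m, m < S (n + j) /\ (x m a /\ hit a n t)).
    + intros a [[m [ha hm]] hat]; exists m; repeat split; auto.
      apply NNPP; intros hlt; apply (hm n j); [lia|lia|].
      apply hj; auto; apply hd; eauto.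
    + apply finite_bigU; intros m _; apply hx.
  - intros y hy; destruct (hGx y hy) as [m <-].
    apply finite_subset with (B := fun a => exists n, n < m /\
      exists j, j < m /\ (x m a /\ hit a n (e j))).
    + intros a [ha hna]; apply NNPP; intros no; apply hna; exists m.
      split; auto; intros n j hn hj h; apply no; eauto 8.
    + apply finite_bigU; intros n _; apply finite_bigU; intros j _; apply hx.
Qed.

(** The rank of [t] is the least length of a list [l] with [covers t l]. Among nodes of equal code
    on levels in [C] it grows strictly along [tlt], so fixing code and rank gives an antichain. *)
Lemma special_of_locally_thin (C : w -> Prop) :
  locally_in_down thin C -> special tlt (restr ht C).
Proof.
  intros hC.
  pose (covers := fun t (l : list w) => forall a, C a -> hit a (code t) t -> In a l).
  pose (rk := fun t m => (exists l, length l = m /\ covers t l) /\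
    forall l, covers t l -> m <= length l).
  assert (hrk : forall t, exists m, rk t m).
  { intros t.
    destruct (hC (fun a => C a /\ olt a (ht t))) as [x [hx hsub]].
    { intros a h; apply h. }
    { apply countable_subset with (B := fun a => olt a (ht t)); [|apply hw].
      intros a h; apply h. }
    destruct (proj2 hx (code t) t) as [l hl].
    assert (hl' : exists m l, length l = m /\ covers t l).
    { exists (length l), l; split; auto; intros a ha hat; apply hl; split; auto.
      apply hsub; split; auto.
      destruct hat as [s [<- [_ hs]]]; apply hht; auto. }
    apply dec_inh_nat_subset_has_unique_least_element in hl'.
    - destruct hl' as [m [[hm hmin] _]]; exists m; split; auto.
      intros k hk; apply hmin; eauto.
    - intros m; apply classic. }
  exists (fun k t => restr ht C t /\ exists m, rk t m /\ k = to_nat (code t, m)).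
  split; [|split].
  - intros k s t [hs [m [[_ hsm] ks]]] [_ [m' [[[l [hl hcov]] _] kt]]] hst.
    rewrite ks in kt; apply to_nat_inj in kt; injection kt as ec em.
    (* A shortest list for [t] contains [ht s]; without that entry it still covers [s], since nodes
       below [s] have smaller height. *)
    assert (hin : In (ht s) l) by (apply hcov; [exact hs|exists s; auto]).
    apply in_split in hin; destruct hin as [l1 [l2 el]].
    assert (hle : m <= length (l1 ++ l2)).
    { apply hsm; intros a ha [r [hr [hc hrs]]].
      assert (h : In a l)
        by (apply hcov; auto; exists r; repeat split; eauto; congruence).
      rewrite el in h; apply in_app_iff in h; apply in_app_iff.
      destruct h as [h|[h|h]]; auto.
      exfalso; apply (olt_irrefl a); rewrite <- h at 2; rewrite <- hr.
      apply hht; auto. }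
    rewrite em, <- hl, el, !length_app in hle; simpl in hle; lia.
  - intros k t h; apply h.
  - intros t ht'; destruct (hrk t) as [m hm]; eauto 6.
Qed.

(** The downward closure of [b] is a maximal chain: [b] has elements higher than any given node, and
    a node comparable with such an element lies below it. *)
Lemma uncountable_chain_branch (b : T -> Prop) :
  chain tlt b -> ~ countable b -> exists b', branch tlt b' /\ ~ countable b'.
Proof.
  intros hb hu; exists (fun s => exists t, b t /\ (tlt s t \/ s = t)).
  split; [split|].
  - intros s s' [t [ht1 hst]] [t' [ht2 hst']].
    assert (h : exists u, (tlt s u \/ s = u) /\ (tlt s' u \/ s' = u)).
    { destruct (hb t t' ht1 ht2) as [h|[h|h]].
      - exists t'; intuition (subst; eauto).
      - exists t'; intuition (subst; eauto).
      - exists t; intuition (subst; eauto). }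
    destruct h as [u [[h1|h1] [h2|h2]]]; subst; auto.
    apply (proj1 (proj2 (proj2 htree)) u); auto.
  - intros c hc hsub s hs.
    destruct (uncountable_diff b (fun t => olt (ht t) (ht s) \/ ht t = ht s) hu)
      as [t [hbt hnt]].
    { apply countable_subset with (B := fun t => exists a,
        (olt a (ht s) \/ a = ht s) /\ ht t = a); [intros t h; eauto|].
      apply countable_Union; [apply omega1_countable_le; auto|].
      intros a _; apply levels_countable. }
    exists t; split; auto.
    destruct (hc s t hs) as [h|[h|h]]; auto.
    + apply hsub; exists t; auto.
    + destruct hnt; left; apply hht; auto.
  - intros h; apply hu; apply countable_subset with (2 := h).
    intros t h'; exists t; auto.
Qed.

(* Either some pair (n, k) is eventually useless, on a smaller unbounded [P],
   for uncountably many [a], and it can be dropped; or any two generic nodes of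
   code [n] lie below a common [L d k], and the nodes lying below co-countably
   many of them form an uncountable chain. *)
Lemma covered_uncountable_chain (L : w -> nat -> T) (cs : list (nat * nat)) :
  forall P B : w -> Prop, unbounded P -> ~ countable B ->
  (forall a, B a -> exists b, forall d, P d -> olt b d ->
     exists n k, In (n, k) cs /\ hit a n (L d k)) ->
  exists b, chain tlt b /\ ~ countable b.
Proof.
  induction cs as [|[n k] cs IH]; intros P B hP hB hcov.
  - exfalso; apply hB; exists (fun _ => 0); intros a a' ha; exfalso.
    destruct (hcov a ha) as [b hb]; destruct (hP b) as [d [hd hbd]].
    destruct (hb d hd hbd) as [? [? [[] _]]].
  - pose (small := fun (Q : w -> Prop) a =>
      B a /\ ~ unbounded (fun d => Q d /\ hit a n (L d k))).
    destruct (classic (exists Q, subset Q P /\ unbounded Q /\ ~ countable (small Q)))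
      as [[Q [hQP [hQ hsm]]]|no].
    (* For [a] in [small Q] the pair (n, k) fails at all large [d] in [Q], so the remaining pairs
       cover. *)
    + apply (IH Q (small Q)); auto.
      intros a [ha hna].
      apply not_all_ex_not in hna; destruct hna as [b1 hb1].
      destruct (hcov a ha) as [b2 hb2].
      destruct (omega1_bound2 hw b1 b2) as [b [h1 h2]].
      exists b; intros d hd hbd.
      destruct (hb2 d) as [n' [k' [[e|hin] h]]];
        [auto|eapply olt_trans; eauto| |eauto].
      injection e as <- <-; destruct hb1; exists d; repeat split; auto.
      eapply olt_trans; eauto.
    + assert (hsm : forall Q, subset Q P -> unbounded Q -> countable (small Q))
        by (intros Q h1 h2; apply NNPP; intros h; apply no; eauto).
      pose (below := fun s a => exists u, ht u = a /\ code u = n /\ tlt s u).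
      exists (fun s => countable (fun a => B a /\ ~ below s a)); split.
      (* Some level in [B] avoids both countable exceptional sets; its node of code [n] lies above
         both [s] and [s']. *)
      * intros s s' hs hs'.
        destruct (uncountable_diff _ _ hB (countable_setU _ _ hs hs'))
          as [a [ha hna]].
        assert (h1 : below s a) by (apply NNPP; tauto).
        assert (h2 : below s' a) by (apply NNPP; tauto).
        destruct h1 as [u [hu [cu h1]]]; destruct h2 as [v [hv [cv h2]]].
        assert (u = v) by (apply hcode; congruence); subst v.
        apply (proj1 (proj2 (proj2 htree)) u); auto.
      (* For [a] in [B] outside [small P], the node of code [n] on level [a] belongs to the chain,
         so a countable chain would make [B] countable. *)
      * intros hc; apply hB.
        assert (hPs : countable (small P)) by (apply hsm; [intros ? ?|]; auto).
        apply countable_subset with (B := fun a => small P a \/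
          exists s, countable (fun a => B a /\ ~ below s a) /\ a = ht s).
        2: { apply countable_setU; auto; apply countable_Union; auto.
             intros s _; apply countable_singleton. }
        intros a ha; apply NNPP; intros hno.
        assert (hun : unbounded (fun d => P d /\ hit a n (L d k)))
          by (apply NNPP; intros h; apply hno; left; split; auto).
        destruct (hun a) as [d0 [[_ [u [hu [cu _]]]] _]].
        apply hno; right; exists u; split; auto.
        apply countable_subset with (B := fun a' =>
          small (fun d => P d /\ hit a n (L d k)) a' \/ (olt a' a \/ a' = a)).
        2: { apply countable_setU; [|apply omega1_countable_le; auto].
             apply hsm; auto; intros d h; apply h. }
        (* Some [L d k] lies above the nodes of code [n] on both levels [a] and [a']; they are
           comparable, and [a'] being above [a] decides the direction. *)
        intros a' [ha' hnb]; apply NNPP; intros hno'; apply hnb.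
        assert (hun' : unbounded (fun d =>
            (P d /\ hit a n (L d k)) /\ hit a' n (L d k)))
          by (apply NNPP; intros h; apply hno'; left; split; auto).
        destruct (hun' a) as [d [[[_ h1] h2] _]].
        destruct h1 as [u1 [hu1 [cu1 h1]]]; destruct h2 as [v [hv [cv h2]]].
        assert (u1 = u) by (apply hcode; congruence); subst u1.
        exists v; repeat split; auto.
        destruct (proj1 (proj2 (proj2 htree)) _ _ _ h1 h2) as [h|[h|h]]; auto;
          exfalso; apply hno'; right.
        -- subst; auto.
        -- left; rewrite <- hu, <- hv; apply hht; auto.
Qed.

(** * Excluding orthogonal sets in the absence of uncountable branches *)

Context (haron : ~ exists b, branch tlt b /\ ~ countable b).

Lemma uncountable_not_covered (B : w -> Prop) (N : nat) (a0 : w) :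
  ~ countable B ->
  exists d, forall L : nat -> T, exists a,
    B a /\ olt a0 a /\ olt a d /\
    forall n k, n < N -> k < N -> ~ hit a n (L k).
Proof.
  intros hB; apply NNPP; intros no; apply haron.
  assert (h : forall d, exists L : nat -> T, forall a,
    B a -> olt a0 a -> olt a d -> exists n k, n < N /\ k < N /\ hit a n (L k)).
  { intros d; apply NNPP; intros no'; apply no; exists d; intros L.
    apply NNPP; intros no2; apply no'; exists L; intros a h1 h2 h3.
    apply NNPP; intros no3; apply no2; exists a; repeat split; auto.
    intros n k hn hk h; apply no3; eauto 6. }
  apply functional_choice in h; destruct h as [L hL].
  destruct (covered_uncountable_chain L (list_prod (seq 0 N) (seq 0 N))
    (fun _ => True) (fun a => B a /\ olt a0 a)) as [b [h1 h2]].
  - intros a; destruct (omega1_bound2 hw a a) as [c [h _]]; eauto.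
  - intros hc; apply hB.
    apply countable_subset with (B := fun a =>
      (B a /\ olt a0 a) \/ (olt a a0 \/ a = a0)).
    + intros a ha; destruct (olt_total w a a0) as [h|[h|h]]; auto.
    + apply countable_setU; auto; apply omega1_countable_le; auto.
  - intros a [ha h0]; exists a; intros d _ had.
    destruct (hL d a ha h0 had) as [n [k [hn [hk h]]]]; exists n, k; split; auto.
    apply in_prod; apply in_seq; lia.
  - eapply uncountable_chain_branch; eauto.
Qed.

Lemma uncountable_not_orthogonal (t0 : T) (B : w -> Prop) :
  ~ countable B -> ~ orthogonal thin B.
Proof.
  intros hB hort.
  (* Here [d] must not depend on [N] or [L]: the nodes [e] to be tested are enumerated only once a
     bound [top] for all [d i] is known. *)
  assert (hg : forall a0, exists d, forall N (L : nat -> T), exists a,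
    B a /\ olt a0 a /\ olt a d /\
    forall n k, n < N -> k < N -> ~ hit a n (L k)).
  { intros a0.
    pose proof (fun N => uncountable_not_covered B N a0 hB) as h.
    apply functional_choice in h; destruct h as [f hf].
    destruct (omega1_bound_seq hw f) as [d hd].
    exists d; intros N L; destruct (hf N L) as [a [h1 [h2 [h3 h4]]]].
    exists a; repeat split; auto; eapply olt_trans; eauto. }
  apply functional_choice in hg; destruct hg as [g hg].
  pose (d := fix d i := match i with 0 => ht t0 | S i => g (d i) end).
  destruct (omega1_bound_seq hw d) as [top htop].
  destruct (hit_enum t0 top) as [e he].
  (* The point [x i] of [B] avoids the first [i] codes under the first [i] nodes of [e], so code n
     under [e j] hits [x i] only for i at most n + j. *)
  pose proof (fun i => hg (d i) i e) as h.
  apply functional_choice in h; destruct h as [x hx].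
  assert (hstep : forall i, olt (x i) (x (S i))).
  { intros i; apply olt_trans with (d (S i)); apply hx. }
  assert (hmono : forall i j, i < j -> olt (x i) (x j)).
  { intros i j hij; induction hij; auto; eapply olt_trans; eauto. }
  assert (hinj : Injective x).
  { intros i j hij; destruct (Nat.lt_total i j) as [h|[h|h]]; auto;
      apply hmono in h; rewrite hij in h; destruct (olt_irrefl _ h). }
  assert (hthin : thin (fun a => exists i, a = x i)).
  { split; [apply countable_range|].
    intros n t; destruct (he t) as [j hj].
    apply finite_subset with
      (B := fun a => exists i, i < S (n + j) /\ a = x i).
    - intros a [[i ->] hit]; exists i; split; auto.
      apply NNPP; intros hlt.
      destruct (hx i) as [_ [_ [hlt' hnot]]].
      apply (hnot n j); [lia|lia|]; apply hj; auto.
      apply olt_trans with (d (S i)); auto; apply htop.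
    - apply finite_bigU; intros i _; exists (x i :: nil); intros a ->; simpl; auto. }
  apply (injective_range_infinite x hinj).
  apply finite_subset with (2 := hort _ hthin).
  intros a [i ->]; split; [apply hx|eauto].
Qed.

End CodedTree.

Theorem theorem5p2 :
  star_s ->
  forall (w : Ord), is_omega1 w ->
  forall (T : Type) (tlt : T -> T -> Prop) (ht : T -> w),
    aronszajn tlt ht -> NS_special tlt ht.
Proof.
  intros star w hw T tlt ht [[htree [hht [hne hlev]]] haron].
  pose proof hlev as hf; apply functional_choice in hf; destruct hf as [f hf].
  pose (code := fun t => f (ht t) t).
  assert (hcode : forall s t, ht s = ht t -> code s = code t -> s = t).
  { intros s t e; unfold code; rewrite e; apply hf; auto. }
  destruct (star w (omega1_uncountable_cof hw)) as [A [hA hdich]].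
  (* An empty tree would leave [w] empty, hence countable. *)
  destruct (classic (exists t0 : T, True)) as [[t0 _]|hemp].
  2: { exfalso; apply (proj1 hw); exists (fun _ => 0); intros a.
       destruct (hne a) as [t _]; destruct hemp; eauto. }
  exists A; split; auto; intros S hS.
  destruct (hdich (thin tlt ht code)) as [h|[B [hB hort]]].
  - eapply thin_sigma_directed; eauto.
  - destruct (h S hS) as [C [h1 [h2 h3]]]; exists C; repeat split; auto.
    + apply h1.
    + apply h1.
    + eapply special_of_locally_thin; eauto.
  - exfalso; revert hort; eapply uncountable_not_orthogonal; eauto.
    apply stationary_uncountable; auto.
Qed.
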